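(* Let $\Gamma$ be a set, $m\ge 1$, and let $\{\mathbb{F}_{\underline{\gamma}} : \underline{\gamma}\in\mathcal{J}_\Gamma\}$ be a system of finite dimensional distributions on $\mathbb{R}^m$ with respect to $\Gamma$, i.e. for each $\underline{\gamma}=(\gamma_1,\dots,\gamma_n)\in\mathcal{J}_\Gamma$, $\mathbb{F}_{\underline{\gamma}}$ is a nonlinear expectation on $(\mathbb{R}^{n\times m},C_{l.Lip}(\mathbb{R}^{n\times m}))$. Assume: (1) (Compatibility) for each $(\gamma_1,\dots,\gamma_n,\gamma_{n+1})\in\mathcal{J}_\Gamma$ and $\varphi\in C_{l.Lip}(\mathbb{R}^{n\times m})$, $\mathbb{F}_{\gamma_1,\dots,\gamma_n}[\varphi]=\mathbb{F}_{\gamma_1,\dots,\gamma_n,\gamma_{n+1}}[\widetilde\varphi]$, where $\widetilde\varphi(y_1,\dots,y_n,y_{n+1})=\varphi(y_1,\dots,y_n)$ for $y_1,\dots,y_{n+1}\in\mathbb{R}^m$; (2) (Symmetry) for each $(\gamma_1,\dots,\gamma_n)\in\mathcal{J}_\Gamma$, $\varphi\in C_{l.Lip}(\mathbb{R}^{n\times m})$ and each permutation $\pi$ of $\{1,\dots,n\}$, $\mathbb{F}_{\gamma_{\pi(1)},\dots,\gamma_{\pi(n)}}[\varphi]=\mathbb{F}_{\gamma_1,\dots,\gamma_n}[\varphi_\pi]$, where $\varphi_\pi(y_1,\dots,y_n)=\varphi(y_{\pi(1)},\dots,y_{\pi(n)})$. Then there exists an $m$-dimensional random field $W=(W_\gamma)_{\gamma\in\Gamma}$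 on some nonlinear expectation space $(\Omega,\mathcal{H},\hat{\mathbb{E}})$ whose family of finite dimensional distributions coincides with $\{\mathbb{F}_{\underline{\gamma}}\}$, i.e. $\hat{\mathbb{E}}[\varphi(W_{\gamma_1},\dots,W_{\gamma_n})]=\mathbb{F}_{\underline{\gamma}}[\varphi]$ for all $\underline{\gamma}=(\gamma_1,\dots,\gamma_n)\in\mathcal{J}_\Gamma$ and $\varphi\in C_{l.Lip}(\mathbb{R}^{n\times m})$. If moreover each $\mathbb{F}_{\underline{\gamma}}$ is sublinear, then the corresponding expectation $\hat{\mathbb{E}}$ on $(\Omega,\mathcal{H})$ is also sublinear.
   Context: $C_{l.Lip}(\mathbb{R}^k)$ is the linear space of functions $\varphi:\mathbb{R}^k\to\mathbb{R}$ for which there are $C>0$, $q\in\mathbb{N}$ (depending on $\varphi$) with $|\varphi(x)-\varphi(y)|\le C(1+|x|^q+|y|^q)|x-y|$ for all $x,y$. Let $\Omega$ be a nonempty set and $\mathcal{H}$ a linear space of real functions on $\Omega$ such that $X_1,\dots,X_k\in\mathcal{H}$ implies $\varphi(X_1,\dots,X_k)\in\mathcal{H}$ for every $\varphi\in C_{l.Lip}(\mathbb{R}^k)$. A functional $\hat{\mathbb{E}}:\mathcal{H}\to\mathbb{R}$ is a nonlinear expectation if it is monotone ($X\ge Y\Rightarrow\hat{\mathbb{E}}[X]\ge\hat{\mathbb{E}}[Y]$) and constant preserving ($\hat{\mathbb{E}}[c]=c$ for $c\in\mathbb{R}$); then $(\Omega,\mathcal{H},\hat{\mathbb{E}})$ is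 a nonlinear expectation space. It is a sublinear expectation if in addition $\hat{\mathbb{E}}[X+Y]\le\hat{\mathbb{E}}[X]+\hat{\mathbb{E}}[Y]$ and $\hat{\mathbb{E}}[\lambda X]=\lambda\hat{\mathbb{E}}[X]$ for $\lambda\ge0$. $\mathcal{J}_\Gamma$ is the set of all finite tuples $(\gamma_1,\dots,\gamma_n)$, $n\in\mathbb{N}$, of pairwise distinct elements of $\Gamma$. An $m$-dimensional random field on $(\Omega,\mathcal{H},\hat{\mathbb{E}})$ indexed by $\Gamma$ is a family $(W_\gamma)_{\gamma\in\Gamma}$ with $W_\gamma\in\mathcal{H}^m$. *)

(* Defs.v *)
From HB Require Import structures.
From mathcomp Require Import all_boot all_order all_algebra all_fingroup.
From mathcomp Require Import classical_sets reals.

Set Implicit Arguments.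
Unset Strict Implicit.
Unset Printing Implicit Defensive.

Import Order.TTheory GRing.Theory Num.Theory.
Local Open Scope classical_set_scope.
Local Open Scope ring_scope.

(* Euclidean norm, 'M[R]_(n, m) being identified with R^(n * m); the norm that
   the analysis library puts on matrices is the sup norm. *)
Definition enorm (R : realType) (n m : nat) (x : 'M[R]_(n, m)) : R :=
  Num.sqrt (\sum_i \sum_j x i j ^+ 2).

Definition C_lLip (R : realType) (n m : nat) : set ('M[R]_(n, m) -> R) :=
  [set phi | exists (C : R) (q : nat), 0 < C /\
     forall x y, `|phi x - phi y|
                 <= C * (1 + enorm x ^+ q + enorm y ^+ q) * enorm (x - y)].

Record function_space (R : realType) (Omega : Type) (H : set (Omega -> R)) :
    Prop := FunctionSpace {
  fs_zero : H (fun=> 0);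
  fs_add : forall X Y, H X -> H Y -> H (fun w => X w + Y w);
  fs_scale : forall (a : R) X, H X -> H (fun w => a * X w);
  fs_comp : forall (k : nat) (X : 'I_k -> Omega -> R) (phi : 'rV[R]_k -> R),
    (0 < k)%N -> (forall i, H (X i)) -> C_lLip phi ->
    H (fun w => phi (\row_i X i w))
}.

(* A functional H -> R is encoded as a total map (Omega -> R) -> R of which
   only the values on H are ever constrained; the constants in ne_const need no
   membership premise, as they belong to every function_space and to C_lLip. *)
Record nonlinear_expectation (R : realType) (Omega : Type)
    (H : set (Omega -> R)) (E : (Omega -> R) -> R) : Prop :=
  NonlinearExpectation {
  ne_monotone : forall X Y, H X -> H Y -> (forall w, Y w <= X w) -> E Y <= E X;
  ne_const : forall c : R, E (fun=> c) = c
}.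

Record sublinear_expectation (R : realType) (Omega : Type)
    (H : set (Omega -> R)) (E : (Omega -> R) -> R) : Prop :=
  SublinearExpectation {
  se_nonlinear : nonlinear_expectation H E;
  se_subadd : forall X Y, H X -> H Y -> E (fun w => X w + Y w) <= E X + E Y;
  se_poshom : forall (a : R) X, 0 <= a -> H X -> E (fun w => a * X w) = a * E X
}.

Record nonlinear_expectation_space (R : realType) (Omega : Type)
    (H : set (Omega -> R)) (E : (Omega -> R) -> R) : Prop :=
  NonlinearExpectationSpace {
  nes_nonempty : inhabited Omega;
  nes_space : function_space H;
  nes_expectation : nonlinear_expectation H E
}.

(* Only lengths n >= 1: a nonlinear expectation on the one-point space R^0 is
   determined by constant preservation. *)
Definition J (Gamma : Type) (n : nat) : set ('I_n -> Gamma) :=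
  [set g | (0 < n)%N /\ injective g].

Definition random_field (R : realType) (Omega : Type) (H : set (Omega -> R))
    (Gamma : Type) (m : nat) (W : Gamma -> Omega -> 'rV[R]_m) : Prop :=
  forall (gamma : Gamma) (j : 'I_m), H (fun w => W gamma w ord0 j).

(* (y_1, ..., y_n) in (R^m)^n is the matrix with rows y_i.  A system of finite
   dimensional distributions is given by F n g : ('M[R]_(n, m) -> R) -> R, which
   is meaningful only for g in J_Gamma and on C_lLip. *)
Definition fdd_functional (R : realType) (Gamma : Type) (m : nat) : Type :=
  forall n : nat, ('I_n -> Gamma) -> ('M[R]_(n, m) -> R) -> R.

Definition fdd_system (R : realType) (Gamma : Type) (m : nat)
    (F : fdd_functional R Gamma m) : Prop :=
  forall (n : nat) (g : 'I_n -> Gamma), J g ->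
    nonlinear_expectation (@C_lLip R n m) (F n g).

Definition fdd_sublinear (R : realType) (Gamma : Type) (m : nat)
    (F : fdd_functional R Gamma m) : Prop :=
  forall (n : nat) (g : 'I_n -> Gamma), J g ->
    sublinear_expectation (@C_lLip R n m) (F n g).

Definition fdd_compatible (R : realType) (Gamma : Type) (m : nat)
    (F : fdd_functional R Gamma m) : Prop :=
  forall (n : nat) (g : 'I_n.+1 -> Gamma) (phi : 'M[R]_(n, m) -> R),
    (0 < n)%N -> J g -> C_lLip phi ->
    F n (fun i => g (widen_ord (leqnSn n) i)) phi
    = F n.+1 g (fun y => phi (rowsub (widen_ord (leqnSn n)) y)).

Definition fdd_symmetric (R : realType) (Gamma : Type) (m : nat)
    (F : fdd_functional R Gamma m) : Prop :=
  forall (n : nat) (g : 'I_n -> Gamma) (phi : 'M[R]_(n, m) -> R) (s : 'S_n),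
    J g -> C_lLip phi ->
    F n (fun i => g (s i)) phi = F n g (fun y => phi (row_perm s y)).

Definition has_fdd (R : realType) (Omega : Type) (E : (Omega -> R) -> R)
    (Gamma : Type) (m : nat) (W : Gamma -> Omega -> 'rV[R]_m)
    (F : fdd_functional R Gamma m) : Prop :=
  forall (n : nat) (g : 'I_n -> Gamma) (phi : 'M[R]_(n, m) -> R),
    J g -> C_lLip phi ->
    E (fun w => phi (\matrix_(i < n) W (g i) w)) = F n g phi.

(* Main.v *)
Require Import Defs.
From HB Require Import structures.
From mathcomp Require Import all_boot all_order all_algebra all_fingroup.
From mathcomp Require Import boolp classical_sets reals.
From mathcomp Require Import lra.

Set Implicit Arguments.
Unset Strict Implicit.
Unset Printing Implicit Defensive.

Import Order.TTheory GRing.Theory Num.Theory.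
Local Open Scope classical_set_scope.
Local Open Scope ring_scope.

(** The proof is Kolmogorov's construction with functionals in the place of
    measures.  The sample space is the space of all maps from [Gamma] to R^m,
    the random variables are the cylinder functions
    [w |-> phi (w (g 0), ..., w (g n.-1))] with [phi] locally Lipschitz and [g]
    injective, and the expectation of such a cylinder function is [F n g phi].
    Since a nonlinear expectation lives on a function space and not on a
    sigma-algebra, the cylinder functions are already the whole domain, and the
    argument is algebraic.

    The point is that the value does not depend on how a cylinder function is
    represented.  Symmetry and compatibility together say that [F] is invariant
    under pullback along every injection of index sets ([fdd_pullback]), and
    finitely many index tuples always embed in a common one ([merge_indices]).
    Hence two cylinder functions may be represented over the same tuple [h]; as
    [h] is injective, every matrix is the restriction to [h] of a sample point,
    so an inequality between the cylinder functions is an inequality between the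
    functions of a matrix that represent them, and monotonicity of [F] applies
    ([cylinder_mono]).  Applied in both directions it gives well-definedness,
    applied once it gives monotonicity of the expectation, and sublinearity is
    likewise read off from a single [F k h].

    The remaining ingredient is that cylinder functions form a function space,
    that is, that locally Lipschitz functions of polynomial growth are stable
    under composition ([C_lLip_comp]). *)

(** * Locally Lipschitz functions of polynomial growth *)

(** The l1 norm is equivalent to the Euclidean one, and its triangle inequality
    is immediate; all estimates below are made with it. *)
Definition norm1 (R : realType) (n m : nat) (x : 'M[R]_(n, m)) : R :=
  \sum_i \sum_j `|x i j|.

Lemma norm1_ge0 (R : realType) (n m : nat) (x : 'M[R]_(n, m)) : 0 <= norm1 x.
Proof. by apply: sumr_ge0 => i _; apply: sumr_ge0. Qed.

Lemma norm1D (R : realType) (n m : nat) (x y : 'M[R]_(n, m)) :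
  norm1 (x + y) <= norm1 x + norm1 y.
Proof.
rewrite /norm1 -big_split; apply: ler_sum => i _.
rewrite -big_split; apply: ler_sum => j _.
by rewrite mxE ler_normD.
Qed.

Lemma enorm_ge0 (R : realType) (n m : nat) (x : 'M[R]_(n, m)) : 0 <= enorm x.
Proof. exact: sqrtr_ge0. Qed.

Lemma norm_entry_le_enorm (R : realType) (n m : nat) (x : 'M[R]_(n, m)) i j :
  `|x i j| <= enorm x.
Proof.
rewrite -sqrtr_sqr /enorm ler_wsqrtr// (bigD1 i)//= (bigD1 j)//= -addrA lerDl.
apply: addr_ge0; first by apply: sumr_ge0 => ? _; rewrite sqr_ge0.
by apply: sumr_ge0 => ? _; apply: sumr_ge0 => ? _; rewrite sqr_ge0.
Qed.

Lemma norm1_le_enorm (R : realType) (n m : nat) (x : 'M[R]_(n, m)) :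
  norm1 x <= (n * m)%:R * enorm x.
Proof.
apply: (@le_trans _ _ (\sum_(i < n) \sum_(j < m) enorm x)).
  by apply: ler_sum => i _; apply: ler_sum => j _; apply: norm_entry_le_enorm.
by rewrite !sumr_const !card_ord mulr_natl mulnC mulrnA.
Qed.

(** With S the sum of all moduli, each squared entry is at most its modulus
    times S. *)
Lemma enorm_le_norm1 (R : realType) (n m : nat) (x : 'M[R]_(n, m)) :
  enorm x <= norm1 x.
Proof.
rewrite -[leRHS](ger0_norm (norm1_ge0 x)) -sqrtr_sqr /enorm ler_wsqrtr//.
rewrite expr2 {1}/norm1 mulr_suml; apply: ler_sum => i _.
rewrite mulr_suml; apply: ler_sum => j _.
rewrite -normr_id -real_normK ?num_real// normr_id expr2 ler_wpM2l//.
rewrite /norm1 (bigD1 i)//= (bigD1 j)//= -addrA lerDl.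
by apply: addr_ge0; apply: sumr_ge0 => // ? _; apply: sumr_ge0.
Qed.

(** Powers of a single weight [1 + norm1 x + norm1 y >= 1] multiply, and grow
    with the exponent; this makes [poly_lip] easier to compose than [C_lLip],
    to which it is equivalent by [C_lLip_poly_lip]. *)
Definition poly_lip (R : realType) (n m p q : nat)
    (f : 'M[R]_(n, m) -> 'M[R]_(p, q)) : Prop :=
  exists (C : R) (d : nat), 0 <= C /\ forall x y,
    norm1 (f x - f y) <= C * (1 + norm1 x + norm1 y) ^+ d * norm1 (x - y).

Lemma norm1_scalar (R : realType) (a : R) : norm1 (a%:M : 'M_1) = `|a|.
Proof. by rewrite /norm1 !big_ord1 mxE eqxx. Qed.

Lemma weight_ge1 (R : realType) (n m : nat) (x y : 'M[R]_(n, m)) :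
  1 <= 1 + norm1 x + norm1 y.
Proof. by rewrite -addrA lerDl addr_ge0 ?norm1_ge0. Qed.

Lemma weight_ge0 (R : realType) (n m : nat) (x y : 'M[R]_(n, m)) :
  0 <= 1 + norm1 x + norm1 y.
Proof. exact: le_trans ler01 (weight_ge1 x y). Qed.

(** The largest of 1, a, b dominates a third of the sum. *)
Lemma expr_weight_le (R : realType) (a b : R) (d : nat) :
  0 <= a -> 0 <= b -> (1 + a + b) ^+ d <= 3 ^+ d * (1 + a ^+ d + b ^+ d).
Proof.
move=> a0 b0; set M := Num.max 1 (Num.max a b).
have w3M : 1 + a + b <= 3 * M.
  have -> : 3 * M = M + M + M by lra.
  by rewrite !lerD// /M !le_max lexx ?orbT.
apply: (@le_trans _ _ ((3 * M) ^+ d)).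
  by rewrite lerXn2r// nnegrE; [lra | apply: le_trans w3M; lra].
rewrite exprMn ler_wpM2l ?exprn_ge0//.
have ad := exprn_ge0 d a0; have bd := exprn_ge0 d b0.
rewrite /M; case: (leP 1 (Num.max a b)) => _; last by rewrite expr1n; lra.
by case: (leP a b) => _; lra.
Qed.

Lemma weight_le_expr (R : realType) (a b : R) (d : nat) :
  0 <= a -> 0 <= b -> 1 + a ^+ d + b ^+ d <= 3 * (1 + a + b) ^+ d.
Proof.
move=> a0 b0; set w := 1 + a + b.
have w1 : 1 <= w ^+ d by rewrite exprn_ege1// /w; lra.
have wa : a ^+ d <= w ^+ d by rewrite lerXn2r// ?nnegrE /w; lra.
have wb : b ^+ d <= w ^+ d by rewrite lerXn2r// ?nnegrE /w; lra.
by lra.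
Qed.

(** The two weights dominate each other up to constants that depend on the
    exponent and on the dimension. *)
Lemma C_lLip_poly_lip (R : realType) (n m : nat) (phi : 'M[R]_(n, m) -> R) :
  C_lLip phi <-> poly_lip (fun x => (phi x)%:M : 'M_1).
Proof.
split=> [[C [d [C0 phiC]]]|[C [d [C0 phiC]]]].
  exists (C * 3), d; split=> [|x y]; first by rewrite mulr_ge0 ?ltW//; lra.
  rewrite -raddfB norm1_scalar; apply: (le_trans (phiC x y)).
  rewrite ler_pM ?enorm_ge0 ?enorm_le_norm1//.
    by rewrite mulr_ge0 ?(ltW C0)// !addr_ge0 ?exprn_ge0 ?enorm_ge0.
  rewrite -mulrA ler_wpM2l ?(ltW C0)//.
  apply: le_trans (weight_le_expr _ (norm1_ge0 _) (norm1_ge0 _)).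
  by rewrite !lerD// lerXn2r ?nnegrE ?enorm_ge0 ?norm1_ge0 ?enorm_le_norm1.
(* The constant of the equivalence of norms, enlarged to be at least 1 so that
   it also bounds the summand 1 of the weight. *)
pose N : R := (n * m)%:R + 1.
have N1 : 1 <= N by rewrite /N lerDr.
have N0 : 0 <= N by apply: le_trans N1.
have leN (x : 'M[R]_(n, m)) : norm1 x <= N * enorm x.
  by apply: le_trans (norm1_le_enorm x) _; rewrite ler_wpM2r ?enorm_ge0// lerDl.
(* [C + 1] because [C_lLip] asks for a positive constant. *)
exists ((C + 1) * (N ^+ d * 3 ^+ d) * N), d; split=> [|x y].
  by rewrite !mulr_gt0 ?exprn_gt0//; lra.
have := phiC x y; rewrite -raddfB norm1_scalar => /le_trans; apply.
apply: (@le_trans _ _ ((C + 1) * (N ^+ d * 3 ^+ d *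
    (1 + enorm x ^+ d + enorm y ^+ d)) * (N * enorm (x - y)))); last first.
  by lra.
rewrite ler_pM ?norm1_ge0 ?leN ?mulr_ge0 ?exprn_ge0 ?weight_ge0//.
rewrite ler_pM ?exprn_ge0 ?weight_ge0 ?lerDl//.
rewrite -mulrA; apply: (@le_trans _ _ ((N * (1 + enorm x + enorm y)) ^+ d)).
  have := leN x; have := leN y; have := weight_ge0 x y.
  have := enorm_ge0 x; have := enorm_ge0 y.
  move=> y0 x0 w0 ly lx; apply: lerXn2r; rewrite ?nnegrE//.
    by rewrite mulr_ge0// !addr_ge0.
  by rewrite !mulrDr; lra.
by rewrite exprMn ler_wpM2l ?exprn_ge0// expr_weight_le ?enorm_ge0.
Qed.

(** The inner function grows at most like a power of the weight, so that the
    weight of the outer estimate is absorbed by a higher power. *)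
Lemma poly_lip_comp (R : realType) (n m p q r s : nat)
    (f : 'M[R]_(n, m) -> 'M[R]_(p, q)) (g : 'M[R]_(p, q) -> 'M[R]_(r, s)) :
  poly_lip f -> poly_lip g -> poly_lip (g \o f).
Proof.
move=> [C [d [C0 fC]]] [K [e [K0 gK]]].
pose M := 1 + 2 * norm1 (f 0) + 2 * C.
have f0 := norm1_ge0 (f 0).
have M0 : 0 <= M by rewrite /M; lra.
exists (K * M ^+ e * C), (d.+1 * e + d)%N; split=> [|x y].
  by rewrite !mulr_ge0 ?exprn_ge0.
set w := 1 + norm1 x + norm1 y.
have w1 : 1 <= w := weight_ge1 x y.
have w0 : 0 <= w := weight_ge0 x y.
have growth z : norm1 z <= norm1 x + norm1 y ->
    norm1 (f z) <= norm1 (f 0) + C * w ^+ d.+1.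
  move=> zw; rewrite -[f z](subrK (f 0)) addrC.
  apply: (le_trans (norm1D _ _)); rewrite lerD2l.
  apply: (le_trans (fC z 0)); rewrite subr0 exprSr mulrA.
  have n0 : norm1 (0 : 'M[R]_(n, m)) = 0.
    by rewrite /norm1 big1// => i _; rewrite big1// => j _; rewrite mxE normr0.
  have z0 := norm1_ge0 z.
  rewrite n0 addr0 ler_pM ?mulr_ge0 ?exprn_ge0//; try by rewrite /w; lra.
  by rewrite ler_wpM2l// lerXn2r// ?nnegrE /w; lra.
have fx := growth x _; have fy := growth y _.
have wd : 1 <= w ^+ d.+1 by rewrite exprn_ege1.
have W : 1 + norm1 (f x) + norm1 (f y) <= M * w ^+ d.+1.
  have {}fx := fx ltac:(by rewrite lerDl norm1_ge0).
  have {}fy := fy ltac:(by rewrite lerDr norm1_ge0).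
  have := ler_wpM2l f0 wd; rewrite mulr1 /M !mulrDl; lra.
apply: (le_trans (gK _ _)) => /=.
apply: (@le_trans _ _
  (K * (M * w ^+ d.+1) ^+ e * (C * w ^+ d * norm1 (x - y)))).
  rewrite ler_pM ?norm1_ge0 ?fC ?mulr_ge0 ?exprn_ge0 ?weight_ge0//.
  by rewrite ler_wpM2l// lerXn2r// ?nnegrE ?weight_ge0// mulr_ge0// exprn_ge0.
rewrite exprMn -exprM exprD; lra.
Qed.

Lemma C_lLip_comp (R : realType) (n m p q : nat)
    (f : 'M[R]_(n, m) -> 'M[R]_(p, q)) (phi : 'M[R]_(p, q) -> R) :
  poly_lip f -> C_lLip phi -> C_lLip (fun x => phi (f x)).
Proof.
move=> pf /C_lLip_poly_lip pphi; apply/C_lLip_poly_lip.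
exact: poly_lip_comp pphi.
Qed.

Lemma poly_lip_row (R : realType) (n m k : nat)
    (psi : 'I_k -> 'M[R]_(n, m) -> R) :
  (forall i, C_lLip (psi i)) -> poly_lip (fun x => \row_i psi i x).
Proof.
move=> psiL; have {psiL} /fin_all_exists2 [C C0 psiC] : forall i, exists2 C : R,
    0 <= C & exists d : nat, forall x y,
      `|psi i x - psi i y| <= C * (1 + norm1 x + norm1 y) ^+ d * norm1 (x - y).
  move=> i; have /C_lLip_poly_lip [C [d [C0 h]]] := psiL i.
  by exists C => //; exists d => x y; rewrite -norm1_scalar raddfB; apply: h.
have {psiC} /fin_all_exists [d psiC] := psiC.
exists (\sum_i C i), (\max_i d i)%N; split=> [|x y]; first exact: sumr_ge0.
rewrite {1}/norm1 big_ord1 -mulrA mulr_suml; apply: ler_sum => i _.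
rewrite !mxE mulrA; apply: (le_trans (psiC i x y)).
rewrite ler_wpM2r ?norm1_ge0// ler_wpM2l//.
by rewrite ler_weXn2l ?weight_ge1// leq_bigmax.
Qed.

Lemma poly_lip_rowsub (R : realType) (n k m : nat) (a : 'I_n -> 'I_k) :
  injective a -> poly_lip (rowsub a : 'M[R]_(k, m) -> 'M[R]_(n, m)).
Proof.
move=> inja; exists 1, 0%N; split=> // x y; rewrite mul1r expr0 mul1r -raddfB.
rewrite /norm1; under eq_bigr do under eq_bigr do rewrite mxE.
rewrite [leRHS](bigID (mem (a @: 'I_n)))/= big_imset/=; last exact: in2W.
by rewrite lerDl; apply: sumr_ge0 => i _; apply: sumr_ge0.
Qed.

Lemma C_lLip_cst (R : realType) (n m : nat) (c : R) :
  C_lLip (fun _ : 'M[R]_(n, m) => c).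
Proof.
exists 1, 0%N; split=> // x y.
by rewrite subrr normr0 !mulr_ge0 ?addr_ge0 ?exprn_ge0 ?enorm_ge0.
Qed.

Lemma C_lLip_entry (R : realType) (n m : nat) i j :
  C_lLip (fun x : 'M[R]_(n, m) => x i j).
Proof.
exists 1, 0%N; split=> // x y; rewrite !expr0 mul1r.
have := norm_entry_le_enorm (x - y) i j; rewrite !mxE.
by have := enorm_ge0 (x - y); lra.
Qed.

Lemma C_lLip_entryD (R : realType) (n m : nat) i j k l :
  C_lLip (fun x : 'M[R]_(n, m) => x i j + x k l).
Proof.
exists 1, 0%N; split=> // x y; rewrite !expr0 mul1r.
have := norm_entry_le_enorm (x - y) i j.
have := norm_entry_le_enorm (x - y) k l.
have := ler_normD ((x - y) i j) ((x - y) k l); rewrite !mxE.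
have -> : x i j + x k l - (y i j + y k l) = x i j - y i j + (x k l - y k l).
  by lra.
by have := enorm_ge0 (x - y); lra.
Qed.

Lemma C_lLip_entryZ (R : realType) (n m : nat) (a : R) i j :
  C_lLip (fun x : 'M[R]_(n, m) => a * x i j).
Proof.
exists (`|a| + 1), 0%N; split=> [|x y]; first by rewrite ltr_wpDl.
rewrite -mulrBr normrM !expr0 -mulrA ler_pM// ?lerDl//.
have := norm_entry_le_enorm (x - y) i j; rewrite !mxE.
by have := enorm_ge0 (x - y); lra.
Qed.

(** Addition and scaling are themselves Lipschitz functions of their arguments,
    so closure under substitution already contains linearity. *)
Lemma function_space_of_comp (R : realType) (Omega : Type)
    (H : set (Omega -> R)) :
  H (fun=> 0) ->
  (forall (k : nat) (X : 'I_k -> Omega -> R) (phi : 'rV[R]_k -> R),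
    (0 < k)%N -> (forall i, H (X i)) -> C_lLip phi ->
    H (fun w => phi (\row_i X i w))) ->
  function_space H.
Proof.
move=> H0 Hcomp; split=> // [X Y HX HY|a X HX].
  have := Hcomp 2 (fun i => if i == ord0 then X else Y) _ isT _
                (C_lLip_entryD R ord0 ord0 ord0 ord_max).
  by under eq_fun do rewrite !mxE/=; apply=> i; case: ifP.
have := Hcomp 1 (fun=> X) _ isT (fun=> HX) (C_lLip_entryZ a ord0 ord0).
by under eq_fun do rewrite mxE.
Qed.

Lemma function_space_C_lLip (R : realType) (n m : nat) :
  function_space (@C_lLip R n m).
Proof.
apply: function_space_of_comp => [|k X phi _ XL phiL]; first exact: C_lLip_cst.
exact: C_lLip_comp (poly_lip_row XL) phiL.
Qed.

(** * Distributions indexed by finite tuples, the empty one included *)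

(** A system of finite dimensional distributions that also has a member for the
    empty tuple, so that arguments on tuples need no case for length 0. *)
Record fdd_consistent (R : realType) (Gamma : Type) (m : nat)
    (F : fdd_functional R Gamma m) : Prop := FddConsistent {
  fdd_expectation : forall (n : nat) (g : 'I_n -> Gamma), injective g ->
    nonlinear_expectation (@C_lLip R n m) (F n g);
  fdd_compat : forall (n : nat) (g : 'I_n.+1 -> Gamma)
      (phi : 'M[R]_(n, m) -> R),
    injective g -> C_lLip phi ->
    F n (fun i => g (widen_ord (leqnSn n) i)) phi
    = F n.+1 g (fun y => phi (rowsub (widen_ord (leqnSn n)) y));
  fdd_sym : forall (n : nat) (g : 'I_n -> Gamma) (phi : 'M[R]_(n, m) -> R)
      (s : 'S_n), injective g -> C_lLip phi ->
    F n (fun i => g (s i)) phi = F n g (fun y => phi (row_perm s y))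
}.

(** On the one-point space R^0 the evaluation is the only constant preserving
    functional.  Including the empty tuple makes the cylinder functions nonempty
    even when there are no indices. *)
Definition fdd_extend (R : realType) (Gamma : Type) (m : nat)
    (F : fdd_functional R Gamma m) : fdd_functional R Gamma m :=
  fun n => if n is n'.+1 then F n'.+1 else fun _ phi => phi 0.

Lemma fdd_extendE (R : realType) (Gamma : Type) (m : nat)
    (F : fdd_functional R Gamma m) n g phi :
  (0 < n)%N -> @fdd_extend R Gamma m F n g phi = F n g phi.
Proof. by case: n g phi. Qed.

Lemma fdd_extend_consistent (R : realType) (Gamma : Type) (m : nat)
    (F : fdd_functional R Gamma m) :
  fdd_system F -> fdd_compatible F -> fdd_symmetric F ->
  fdd_consistent (fdd_extend F).
Proof.
move=> Fexp Fcomp Fsym.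
split=> [[|n] g injg|[|n] g phi injg phiL|[|n] g phi s injg phiL].
- by split=> // X Y _ _; apply.
- exact: Fexp.
- have -> : (fun y => phi (rowsub (widen_ord (leqnSn 0)) y)) = fun=> phi 0.
    by apply/funext => y; congr phi; apply: flatmx0.
  by rewrite /= (ne_const (Fexp 1%N g _)).
- exact: Fcomp.
- by rewrite /=; congr phi; rewrite [RHS]flatmx0.
- exact: Fsym.
Qed.

Lemma fdd_extend_sublinear (R : realType) (Gamma : Type) (m : nat)
    (F : fdd_functional R Gamma m) :
  fdd_sublinear F -> forall (n : nat) (g : 'I_n -> Gamma), injective g ->
  sublinear_expectation (@C_lLip R n m) (fdd_extend F g).
Proof.
move=> Fsub [|n] g injg; last exact: Fsub.
by split=> //; split=> // X Y _ _; apply.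
Qed.

Lemma fdd_pullback_onto (R : realType) (Gamma : Type) (m : nat)
    (F : fdd_functional R Gamma m) (n : nat) (h : 'I_n -> Gamma)
    (a : 'I_n -> 'I_n) (phi : 'M[R]_(n, m) -> R) :
  fdd_consistent F -> injective h -> injective a -> C_lLip phi ->
  F n (fun i => h (a i)) phi = F n h (fun y => phi (rowsub a y)).
Proof.
move=> Fc injh inja phiL; have aE : a = perm inja :> ('I_n -> 'I_n).
  by apply/funext => i; rewrite permE.
rewrite aE (fdd_sym Fc)//; congr (F n h); apply/funext => y; congr phi.
by apply/matrixP => i j; rewrite !mxE.
Qed.

(** Induction on [k].  If [a] is onto, it is a permutation and symmetry applies.
    Otherwise a transposition moves an index missed by [a] to the last place;
    the remaining indices are covered by [k - 1] rows, so compatibility drops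
    the last row. *)
Lemma fdd_pullback (R : realType) (Gamma : Type) (m : nat)
    (F : fdd_functional R Gamma m) (n k : nat) (h : 'I_k -> Gamma)
    (a : 'I_n -> 'I_k) (phi : 'M[R]_(n, m) -> R) :
  fdd_consistent F -> injective h -> injective a -> C_lLip phi ->
  F n (fun i => h (a i)) phi = F k h (fun y => phi (rowsub a y)).
Proof.
move=> Fc; elim: k h a => [|k IHk] h a injh inja phiL; have := leq_card a inja;
  rewrite !card_ord leq_eqVlt => /orP[/eqP nk|ltnk].
- by subst n; exact: (fdd_pullback_onto Fc injh inja phiL).
- by [].
- by subst n; exact: (fdd_pullback_onto Fc injh inja phiL).
have [j jNa] : exists j, j \notin codom a.
  apply/existsP; rewrite -[X in is_true X]negbK negb_exists.
  apply/negP => /forallP aT.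
  have : #|codom a| = #|'I_k.+1|.
    by apply: eq_card => i; rewrite (negbNE (aT i)).
  by rewrite card_codom// !card_ord => nk; rewrite nk ltnn in ltnk.
pose t := tperm j ord_max.
have ta_lt i : (t (a i) < k)%N.
  rewrite ltn_neqAle -ltnS ltn_ord andbT; apply: contraNN jNa => /eqP tai.
  have /(congr1 t) : t (a i) = ord_max by apply: val_inj.
  by rewrite tpermK tpermR => <-; exact: codom_f.
have injw : injective (widen_ord (leqnSn k)).
  by move=> i i' /(congr1 val) /= /val_inj.
pose b i : 'I_k := Ordinal (ta_lt i).
have tb i : t (widen_ord (leqnSn k) (b i)) = a i.
  by rewrite (_ : widen_ord _ _ = t (a i)) ?tpermK//; apply: val_inj.
have injht : injective (fun i => h (t i)) by move=> ? ? /injh /perm_inj.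
have injb : injective b.
  by move=> i i' bb; apply: inja; rewrite -!tb bb.
rewrite (_ : (fun i => h (a i)) =
             fun i => h (t (widen_ord (leqnSn k) (b i)))); last first.
  by apply/funext => i; rewrite tb.
have phibL : C_lLip (fun y : 'M[R]_(k, m) => phi (rowsub b y)).
  exact: C_lLip_comp (poly_lip_rowsub R m injb) phiL.
rewrite (IHk (fun i => h (t (widen_ord (leqnSn k) i))))//; last first.
  by move=> i i' /injht /injw.
rewrite (fdd_compat Fc (g := fun i => h (t i)))// (fdd_sym Fc)//; last first.
  exact: C_lLip_comp (poly_lip_rowsub R m injw) phibL.
congr (F _ h); apply/funext => y; congr phi.
by apply/matrixP => i l; rewrite !mxE tb.
Qed.

(** * Cylinder functions *)

Definition cylinder (R : realType) (Gamma : Type) (m n : nat)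
    (g : 'I_n -> Gamma) (phi : 'M[R]_(n, m) -> R) (w : Gamma -> 'rV[R]_m) : R :=
  phi (\matrix_(i < n) w (g i)).

Definition cylinders (R : realType) (Gamma : Type) (m : nat) :
    set ((Gamma -> 'rV[R]_m) -> R) :=
  [set X | exists (n : nat) (g : 'I_n -> Gamma) (phi : 'M[R]_(n, m) -> R),
    [/\ injective g, C_lLip phi & X = cylinder g phi]].

(** A cylinder function has many representations, and [xget] takes the value
    that some one of them gives; 0 is a default off the cylinder functions. *)
Definition cylinder_expectation (R : realType) (Gamma : Type) (m : nat)
    (F : fdd_functional R Gamma m) (X : (Gamma -> 'rV[R]_m) -> R) : R :=
  xget 0 [set v |
    exists (n : nat) (g : 'I_n -> Gamma) (phi : 'M[R]_(n, m) -> R),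
    [/\ injective g, C_lLip phi, X = cylinder g phi & v = F n g phi]].

(** The common tuple enumerates the finite set of all values of the [g i]. *)
Lemma merge_indices (Gamma : Type) (I : finType) (d : I -> nat)
    (g : forall i, 'I_(d i) -> Gamma) :
  exists (k : nat) (h : 'I_k -> Gamma) (a : forall i, 'I_(d i) -> 'I_k),
    injective h /\ forall i r, h (a i r) = g i r.
Proof.
pose s : seq {classic Gamma} :=
  undup [seq (g (tag p) (tagged p) : {classic Gamma}) | p : {i : I & 'I_(d i)}].
have gs i r : (g i r : {classic Gamma}) \in s.
  by rewrite mem_undup; apply/codomP; exists (existT _ i r).
have idx i r : (index (g i r : {classic Gamma}) s < size s)%N.
  by rewrite index_mem.
exists (size s), (tnth (in_tuple s)), (fun i r => Ordinal (idx i r)); split.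
  by apply/(tuple_uniqP (in_tuple s)); exact: undup_uniq.
by move=> i r; rewrite (tnth_nth (g i r : {classic Gamma})) nth_index.
Qed.

Lemma cylinder_rowsub (R : realType) (Gamma : Type) (m n k : nat)
    (g : 'I_n -> Gamma) (h : 'I_k -> Gamma) (a : 'I_n -> 'I_k)
    (phi : 'M[R]_(n, m) -> R) :
  (forall i, h (a i) = g i) ->
  cylinder g phi = cylinder h (fun y => phi (rowsub a y)).
Proof.
move=> hag; apply/funext => w; congr phi.
by apply/matrixP => i j; rewrite !mxE hag.
Qed.

Lemma factor_inj (A B C : Type) (g : A -> C) (h : B -> C) (a : A -> B) :
  injective g -> (forall i, h (a i) = g i) -> injective a.
Proof. by move=> injg hag x y axy; apply: injg; rewrite -!hag axy. Qed.

(** Distinct indices can be given values independently; the sample point is 0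
    off the range of [h]. *)
Lemma matrix_of_sample (R : realType) (Gamma : Type) (m k : nat)
    (h : 'I_k -> Gamma) (y : 'M[R]_(k, m)) :
  injective h -> exists w : Gamma -> 'rV[R]_m, \matrix_(i < k) w (h i) = y.
Proof.
move=> injh; have /choice[w wP] : forall c : Gamma, exists v : 'rV[R]_m,
    forall i, h i = c -> v = row i y.
  move=> c; have [[i <-]|Nc] := pselect (exists i, h i = c).
    by exists (row i y) => i' /injh ->.
  by exists 0 => i hi; case: Nc; exists i.
by exists w; apply/row_matrixP => i; rewrite rowK; exact: wP.
Qed.

(** Over a common tuple the pointwise inequality becomes an inequality between
    functions of a matrix, because every matrix comes from a sample point. *)
Lemma cylinder_mono (R : realType) (Gamma : Type) (m : nat)
    (F : fdd_functional R Gamma m) (n n' : nat) (g : 'I_n -> Gamma)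
    (g' : 'I_n' -> Gamma) (phi : 'M[R]_(n, m) -> R) (psi : 'M[R]_(n', m) -> R) :
  fdd_consistent F -> injective g -> injective g' -> C_lLip phi -> C_lLip psi ->
  (forall w, cylinder g phi w <= cylinder g' psi w) -> F n g phi <= F n' g' psi.
Proof.
move=> Fc injg injg' phiL psiL le_cyl.
(* The pair [(g, g')] is a family indexed by the booleans. *)
have [k [h [a [injh ha]]]] := @merge_indices Gamma bool
  (fun b => if b then n else n')
  (fun b => if b return 'I_(if b then n else n') -> Gamma then g else g').
have /= hag := ha true; have /= hag' := ha false.
have inja := factor_inj injg hag; have inja' := factor_inj injg' hag'.
have -> : g = fun i => h (a true i) by apply/funext => i; rewrite hag.
have -> : g' = fun i => h (a false i) by apply/funext => i; rewrite hag'.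
rewrite (fdd_pullback Fc injh inja phiL) (fdd_pullback Fc injh inja' psiL).
apply: (ne_monotone (fdd_expectation Fc injh)).
- exact: C_lLip_comp (poly_lip_rowsub R m inja') psiL.
- exact: C_lLip_comp (poly_lip_rowsub R m inja) phiL.
move=> y; have [w wy] := matrix_of_sample y injh; have := le_cyl w.
by rewrite (cylinder_rowsub _ hag) (cylinder_rowsub _ hag') /cylinder wy.
Qed.

Lemma cylinder_expectationE (R : realType) (Gamma : Type) (m : nat)
    (F : fdd_functional R Gamma m) (n : nat) (g : 'I_n -> Gamma)
    (phi : 'M[R]_(n, m) -> R) :
  fdd_consistent F -> injective g -> C_lLip phi ->
  cylinder_expectation F (cylinder g phi) = F n g phi.
Proof.
move=> Fc injg phiL; apply: xget_unique; first by exists n, g, phi.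
move=> _ [n' [g' [psi [injg' psiL cyl_eq ->]]]].
by apply/le_anti/andP; split; apply: cylinder_mono => // w; rewrite cyl_eq.
Qed.

(** Finitely many cylinder functions depend on finitely many coordinates in
    total, so they are functions of one and the same random matrix. *)
Lemma cylinders_common (R : realType) (Gamma : Type) (m : nat) (I : finType)
    (X : I -> (Gamma -> 'rV[R]_m) -> R) :
  (forall i, cylinders (X i)) ->
  exists (k : nat) (h : 'I_k -> Gamma) (psi : I -> 'M[R]_(k, m) -> R),
    injective h /\ forall i, C_lLip (psi i) /\ X i = cylinder h (psi i).
Proof.
move=> /fin_all_exists[d] /fin_all_exists[g] /fin_all_exists[phi XP].
have [k [h [a [injh ha]]]] := merge_indices g.
exists k, h, (fun i y => phi i (rowsub (a i) y)); split=> // i.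
have [injg phiL XE] := XP i; split; last by rewrite XE; exact: cylinder_rowsub.
exact: C_lLip_comp (poly_lip_rowsub R m (factor_inj injg (ha i))) phiL.
Qed.

Lemma cylinders_common2 (R : realType) (Gamma : Type) (m : nat)
    (X Y : (Gamma -> 'rV[R]_m) -> R) :
  cylinders X -> cylinders Y ->
  exists (k : nat) (h : 'I_k -> Gamma) (phi psi : 'M[R]_(k, m) -> R),
    [/\ injective h, C_lLip phi, C_lLip psi, X = cylinder h phi
      & Y = cylinder h psi].
Proof.
move=> HX HY; have [|k [h [psi [injh psiP]]]] :=
  @cylinders_common R Gamma m bool (fun b => if b then X else Y); first by case.
have [? ?] := psiP true; have [? ?] := psiP false.
by exists k, h, (psi true), (psi false).
Qed.

Lemma cylinder_cst (R : realType) (Gamma : Type) (m : nat) (c : R) :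
  exists g : 'I_0 -> Gamma,
    injective g /\ (fun=> c) = cylinder g (fun _ : 'M[R]_(0, m) => c).
Proof.
have g (i : 'I_0) : Gamma by case: i.
by exists g; split=> // -[].
Qed.

Lemma function_space_cylinders (R : realType) (Gamma : Type) (m : nat) :
  function_space (@cylinders R Gamma m).
Proof.
apply: function_space_of_comp => [|k X phi _ XH phiL].
  have [g [injg cE]] := cylinder_cst Gamma m (0 : R).
  by exists 0%N, g, (fun=> 0); split=> //; exact: C_lLip_cst.
have [n [h [psi [injh psiP]]]] := cylinders_common XH.
exists n, h, (fun y => phi (\row_i psi i y)); split=> //.
  by apply: C_lLip_comp phiL; apply: poly_lip_row => i; case: (psiP i).
apply/funext => w; congr phi; apply/rowP => i; rewrite !mxE.
by case: (psiP i) => _ ->.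
Qed.

Lemma cylinder_expectation_nonlinear (R : realType) (Gamma : Type) (m : nat)
    (F : fdd_functional R Gamma m) :
  fdd_consistent F ->
  nonlinear_expectation (@cylinders R Gamma m) (cylinder_expectation F).
Proof.
move=> Fc; split=> [X Y|c].
  move=> [n [g [phi [injg phiL ->]]]] [n' [g' [psi [injg' psiL ->]]]] le_cyl.
  by rewrite !cylinder_expectationE//; exact: cylinder_mono.
have [g [injg ->]] := cylinder_cst Gamma m c.
rewrite cylinder_expectationE//; last exact: C_lLip_cst.
exact: (ne_const (fdd_expectation Fc injg)).
Qed.

Lemma cylinder_expectation_sublinear (R : realType) (Gamma : Type) (m : nat)
    (F : fdd_functional R Gamma m) :
  fdd_consistent F ->
  (forall (n : nat) (g : 'I_n -> Gamma), injective g ->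
    sublinear_expectation (@C_lLip R n m) (F n g)) ->
  sublinear_expectation (@cylinders R Gamma m) (cylinder_expectation F).
Proof.
move=> Fc Fsub; split; first exact: cylinder_expectation_nonlinear.
  move=> X Y /cylinders_common2 /[apply].
  move=> [k [h [phi [psi [injh phiL psiL -> ->]]]]].
  have phipsiL := fs_add (function_space_C_lLip R k m) phiL psiL.
  have := cylinder_expectationE Fc injh phipsiL.
  rewrite /cylinder => ->; rewrite !cylinder_expectationE//.
  exact: se_subadd (Fsub _ _ injh) _ _ phiL psiL.
move=> a _ a0 [n [g [phi [injg phiL ->]]]].
have aphiL := fs_scale (function_space_C_lLip R n m) a phiL.
have := cylinder_expectationE Fc injg aphiL.
rewrite /cylinder => ->; rewrite cylinder_expectationE//.
exact: se_poshom (Fsub _ _ injg) _ _ a0 phiL.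
Qed.

Theorem theorem15 (R : realType) (Gamma : Type) (m : nat) (hm : (0 < m)%N)
    (F : fdd_functional R Gamma m)
    (hF : fdd_system F)
    (hcompat : fdd_compatible F)
    (hsym : fdd_symmetric F) :
  exists (Omega : Type) (H : set (Omega -> R)) (E : (Omega -> R) -> R)
         (W : Gamma -> Omega -> 'rV[R]_m),
    [/\ nonlinear_expectation_space H E,
        random_field H W,
        has_fdd E W F
      & fdd_sublinear F -> sublinear_expectation H E].
Proof.
have Fc := fdd_extend_consistent hF hcompat hsym.
exists (Gamma -> 'rV[R]_m), (@cylinders R Gamma m),
  (cylinder_expectation (fdd_extend F)), (fun gamma w => w gamma); split.
- split; first exact: inhabits (fun=> 0).
    exact: function_space_cylinders.
  exact: cylinder_expectation_nonlinear.
- move=> gamma j; exists 1%N, (fun=> gamma), (fun y => y ord0 j); split.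
  + by move=> i i' _; rewrite !ord1.
  + exact: C_lLip_entry.
  + by apply/funext => w; rewrite /cylinder mxE.
- move=> n g phi [n0 injg] phiL; rewrite -(fdd_extendE F g phi n0).
  exact: cylinder_expectationE.
- move=> Fsub; apply: cylinder_expectation_sublinear => //.
  exact: fdd_extend_sublinear.
Qed.
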